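(* Let $H$ be a group which is finitely presented with respect to a collection of subgroups $\{H_\lambda\}_{\lambda\in\Lambda}\cup\{K\}$, and suppose that the corresponding relative Dehn function $\gamma$ is well-defined. Assume also that $K$ is finitely generated and that for some $\nu\in\Lambda$ there exists a monomorphism $\iota:K\to H_\nu$. Then the HNN-extension $$G=\langle H,t\mid t^{-1}kt=\iota(k),\ k\in K\rangle$$ is finitely presented relative to $\{H_\lambda\}_{\lambda\in\Lambda}$. Moreover, the relative Dehn function $\delta$ of $G$ with respect to $\{H_\lambda\}_{\lambda\in\Lambda}$ is well-defined and satisfies $$\delta\preceq\overline{\gamma}\circ\overline{\gamma},$$ where $\overline{\gamma}$ is the superadditive closure of $\gamma$.
   Context: **Relative presentations.** Let $G$ be a group, $\{H_\lambda\}_{\lambda\in\Lambda}$ a collection of subgroups of $G$ and $X\subseteq G$ a subset, always assumed symmetrized ($X^{-1}=X$). $X$ is a relative generating set of $G$ with respect to $\{H_\lambda\}_{\lambda\in\Lambda}$ if $G$ is generated by $X\cup\bigcup_{\lambda}H_\lambda$. Then $G$ is a quotient of the free product $F=(\ast_{\lambda\in\Lambda}H_\lambda)\ast F(X)$, where $F(X)$ is the free group with basis $X$. If the kernel of the natural homomorphism $F\to G$ is the normal closure in $F$ of a subset $\mathcal R$, one says that $G$ has the relative presentation $\langle X, H_\lambda,\lambda\in\Lambda\mid\mathcal R\rangle$. It is finite if $X$ and $\mathcal R$ are finite (there is no finiteness restriction on $\Lambda$ or on the $H_\lambda$); if a finite relative presentation exists, $G$ is said to be finitely presented relative to (with respect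 to) $\{H_\lambda\}_{\lambda\in\Lambda}$. **Relative Dehn functions.** Put $\mathcal H=\bigsqcup_{\lambda\in\Lambda}(H_\lambda\setminus\{1\})$. For a word $W$ in the alphabet $X\cup\mathcal H$ representing $1$ in $G$, the relative area $Area^{rel}(W)$ is the smallest $k$ such that $W=\prod_{i=1}^k f_i^{-1}R_i^{\pm1}f_i$ in $F$ with $R_i\in\mathcal R$, $f_i\in F$. A function $f:\mathbb N\to\mathbb N$ is a relative isoperimetric function if for every $n$ and every word $W$ in $X\cup\mathcal H$ of length at most $n$ representing $1$ in $G$, $Area^{rel}(W)\le f(n)$. The smallest relative isoperimetric function is the relative Dehn function of $G$ with respect to $\{H_\lambda\}_{\lambda\in\Lambda}$; it is well-defined if these relative areas are bounded for each $n$ (this may fail, as there may be infinitely many words of a given length). For a group finitely presented relative to the collection, relative Dehn functions are taken with respect to finite relative presentations; when well-defined, the function does not depend on the finite relative presentation up to the equivalence relation ($f\preceq g$ and $g\preceq f$) defined below. **Comparison.** For $f,g:\mathbb N\to\mathbb N$, write $f\preceq g$ if there are positive constants $A,B,C$ such that $f(n)\le A\,g(Bn)+Cn$ for all $n$. **Superadditive closure.** $f:\mathbb N\to\mathbb N$ is superadditive if $f(a+b)\ge f(a)+f(b)$ for all $a,b\in\mathbb N$. The superadditive closure of $f$ is $$\overline f(n)=\max_{i=1,\dots,n}\ \max_{a_1+\dots+a_i=n,\ a_j\in\mathbb N}\bigl(f(a_1)+\dots+f(a_i)\bigr),$$ the smallest superadditive function with $\overline f(n)\ge f(n)$ for all $n$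 (Dehn functions vanish at $0$, and $\overline f(0)=0$ for them). *)

(* Defs.v *)
From HB Require Import structures.
From mathcomp Require Import all_boot.
From mathcomp Require Import boolp classical_sets cardinality.

Set Implicit Arguments.
Unset Strict Implicit.
Unset Printing Implicit Defensive.

Local Open Scope classical_set_scope.
Local Open Scope group_scope.
Local Open Scope quotient_scope.

(* S is a boolean predicate; with the classical axioms of [boolp] this is as
   general as an arbitrary subset of G closed under the group operations. *)
Section Subgrp.
Variables (G : groupType) (S : groupClosed G).
Record subgrp : Type := Subgrp { subgrp_val : G; _ : subgrp_val \in S }.
HB.instance Definition _ := [isSub for subgrp_val].
HB.instance Definition _ := [Choice of subgrp by <:].
Fact subgrp_closed : group_closed S.
Proof. by split; [exact: gpred1 | exact: gpredF]. Qed.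
HB.instance Definition _ :=
  SubChoice_isSubGroup.Build G _ subgrp subgrp_closed.
End Subgrp.

Definition generated (G : groupType) (A : set G) : set G :=
  [set g | forall N : groupClosed G, (forall a, A a -> a \in N) -> g \in N].

Definition finitely_generated (G : groupType) (S : groupClosed G) : Prop :=
  exists2 Y : set G, finite_set Y & generated Y = [set` S].

Section ImageSubgroup.
Variables (G H : groupType) (f : {multiplicative H -> G}) (S : groupClosed H).
Definition img : {pred G} := fun g => `[< exists2 h, h \in S & f h = g >].

Fact imgP g : reflect (exists2 h, h \in S & f h = g) (g \in img).
Proof. exact: asboolP. Qed.
Fact img_mulg : mulg_closed img.
Proof.
move=> _ _ /imgP[x Sx <-] /imgP[y Sy <-].
by apply/imgP; exists (x * y); [exact: gpredM | rewrite gmulfM].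
Qed.
Fact img_one : 1 \in img.
Proof.
apply/imgP; exists 1; first exact: gpred1.
by apply: (mulgI (f 1)); rewrite -gmulfM !mulg1.
Qed.
Fact img_invg : invg_closed img.
Proof.
move=> _ /imgP[x Sx <-]; apply/imgP; exists x^-1; first exact: gpredVr.
apply: (mulgI (f x)); rewrite -gmulfM !mulgV.
by apply: (mulgI (f 1)); rewrite -gmulfM !mulg1.
Qed.
HB.instance Definition _ := isMulClosed.Build G img img_mulg.
HB.instance Definition _ := isMul1Closed.Build G img img_one.
HB.instance Definition _ := isInvClosed.Build G img img_invg.
Definition image_subgroup : groupClosed G := img.
End ImageSubgroup.

Definition normal_subgroup (G : groupType) (N : groupClosed G) : Prop :=
  forall x g, x \in N -> x ^ g \in N.

Definition normal_closure (G : groupType) (R : set G) : set G :=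
  [set g | forall N : groupClosed G,
     normal_subgroup N -> (forall r, R r -> r \in N) -> g \in N].

Section QuotientByNormalClosure.
Variables (G : groupType) (R : set G).

Definition ncl_rel (x y : G) : bool := `[< normal_closure R (x^-1 * y) >].

Fact ncl_relP x y : reflect (normal_closure R (x^-1 * y)) (ncl_rel x y).
Proof. exact: asboolP. Qed.
Fact ncl_refl : reflexive ncl_rel.
Proof. by move=> x; apply/ncl_relP => N nN RN; rewrite mulVg gpred1. Qed.
Fact ncl_sym : symmetric ncl_rel.
Proof.
suff h x y : ncl_rel x y -> ncl_rel y x by move=> x y; apply/idP/idP; exact: h.
move=> /ncl_relP xy; apply/ncl_relP => N nN RN.
by rewrite -gpredV invgM invgK xy.
Qed.
Fact ncl_trans : transitive ncl_rel.
Proof.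
move=> y x z /ncl_relP xy /ncl_relP yz; apply/ncl_relP => N nN RN.
by rewrite -(mulVKg y z) mulgA gpredM ?xy ?yz.
Qed.
Canonical ncl_equiv := EquivRel ncl_rel ncl_refl ncl_sym ncl_trans.

(* G / <<R>>, the group obtained from G by adding the relations R. *)
Definition add_relations := {eq_quot ncl_equiv}.
Local Notation Q := add_relations.
HB.instance Definition _ := Choice.on Q.

Definition qproj (x : G) : Q := \pi_({eq_quot ncl_equiv}) x.
Definition qmul (x y : Q) : Q := qproj (repr x * repr y).
Definition qinv (x : Q) : Q := qproj (repr x)^-1.

Lemma qprojP x y : qproj x = qproj y <-> normal_closure R (x^-1 * y).
Proof.
split=> [/eqmodP/ncl_relP //|h]; exact/eqmodP/ncl_relP.
Qed.
Lemma qreprK x : qproj (repr x) = x. Proof. exact: reprK. Qed.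
Lemma qmulE x y : qmul (qproj x) (qproj y) = qproj (x * y).
Proof.
apply/qprojP => N nN RN.
have /qprojP/(_ N nN RN) hx := qreprK (qproj x).
have /qprojP/(_ N nN RN) hy := qreprK (qproj y).
move: (repr (qproj x)) (repr (qproj y)) hx hy => x' y' hx hy.
have -> : (x' * y')^-1 * (x * y) = (x'^-1 * x) ^ y' * (y'^-1 * y).
  by rewrite /conjg invgM !mulgA mulgK.
by rewrite gpredM ?nN.
Qed.
Lemma qinvE x : qinv (qproj x) = qproj x^-1.
Proof.
apply/qprojP => N nN RN.
have /qprojP/(_ N nN RN) hx := qreprK (qproj x).
move: (repr (qproj x)) hx => x' hx; rewrite invgK.
have -> : x' * x^-1 = ((x'^-1 * x)^-1) ^ x'^-1.
  by rewrite /conjg invgM !invgK !mulgA mulgK.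
by rewrite nN ?gpredV.
Qed.
Fact qmulA : associative qmul.
Proof.
move=> x y z; rewrite -(qreprK x) -(qreprK y) -(qreprK z).
by rewrite !qmulE mulgA.
Qed.
Fact qmul1 : left_id (qproj 1) qmul.
Proof. by move=> x; rewrite -(qreprK x) qmulE mul1g. Qed.
Fact qmulg1 : right_id (qproj 1) qmul.
Proof. by move=> x; rewrite -(qreprK x) qmulE mulg1. Qed.
Fact qmulV : left_inverse (qproj 1) qinv qmul.
Proof. by move=> x; rewrite -(qreprK x) qinvE qmulE mulVg. Qed.
Fact qmulgV : right_inverse (qproj 1) qinv qmul.
Proof. by move=> x; rewrite -(qreprK x) qinvE qmulE mulgV. Qed.
HB.instance Definition _ := isGroup.Build Q qmulA qmul1 qmulg1 qmulV qmulgV.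

Fact qproj_morph : {morph qproj : x y / x * y}.
Proof. by move=> x y; exact/esym/qmulE. Qed.
HB.instance Definition _ := isMultiplicative.Build G Q qproj qproj_morph.
End QuotientByNormalClosure.

Section FreeProduct.
Variables (T I : Type) (A : I -> groupType).

(* [FGen x true] stands for x and [FGen x false] for its formal inverse. *)
Inductive fletter : Type :=
| FGen of T & bool
| FElt i of A i.

Inductive feq : seq fletter -> seq fletter -> Prop :=
| feq_refl u : feq u u
| feq_sym u v : feq u v -> feq v u
| feq_trans u v w : feq u v -> feq v w -> feq u w
| feq_cat u u' v v' : feq u u' -> feq v v' -> feq (u ++ v) (u' ++ v')
| feq_cancel x b : feq [:: FGen x b; FGen x (~~ b)] [::]
| feq_one i : feq [:: FElt (1 : A i)] [::]
| feq_mul i (a b : A i) : feq [:: FElt a; FElt b] [:: FElt (a * b)].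

HB.instance Definition _ := gen_eqMixin fletter.
HB.instance Definition _ := gen_choiceMixin fletter.

Definition feqb (u v : seq fletter) : bool := `[< feq u v >].
Fact feqb_refl : reflexive feqb.
Proof. by move=> u; apply/asboolP; exact: feq_refl. Qed.
Fact feqb_sym : symmetric feqb.
Proof. by move=> u v; apply/asboolP/asboolP; exact: feq_sym. Qed.
Fact feqb_trans : transitive feqb.
Proof. move=> v u w /asboolP uv /asboolP vw; exact/asboolP/(feq_trans uv). Qed.
Canonical feq_equiv := EquivRel feqb feqb_refl feqb_sym feqb_trans.

(* F(T) * ( *_i A_i ): the free product of the groups A_i and of the free
   group with basis T. *)
Definition freeprod := {eq_quot feq_equiv}.
HB.instance Definition _ := Choice.on freeprod.

Definition fclass (u : seq fletter) : freeprod := \pi_({eq_quot feq_equiv}) u.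
Definition fmul (x y : freeprod) := fclass (repr x ++ repr y).
Definition finv_letter a :=
  match a with FGen x b => FGen x (~~ b) | FElt _ a => FElt a^-1 end.
Definition finv_word u := rev (map finv_letter u).
Definition finv (x : freeprod) := fclass (finv_word (repr x)).

Lemma fclassP u v : fclass u = fclass v <-> feq u v.
Proof. by split=> [/eqmodP/asboolP //|h]; exact/eqmodP/asboolP. Qed.
Lemma freprK x : fclass (repr x) = x. Proof. exact: reprK. Qed.
Lemma fmulE u v : fmul (fclass u) (fclass v) = fclass (u ++ v).
Proof. by apply/fclassP/feq_cat; apply/fclassP; rewrite freprK. Qed.

Fact feq_inv u v : feq u v -> feq (finv_word u) (finv_word v).
Proof.
rewrite /finv_word; elim=> {u v}.
- by move=> u; exact: feq_refl.
- by move=> u v _; exact: feq_sym.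
- by move=> u v w _ uv _; exact: feq_trans.
- by move=> u u' v v' _ hu _ hv; rewrite !map_cat !rev_cat; exact: feq_cat.
- by move=> x b; rewrite /= negbK; exact: feq_cancel.
- by move=> i; rewrite /= invg1; exact: feq_one.
- by move=> i a b; rewrite /= invgM; exact: feq_mul.
Qed.
Fact feq_mulV u : feq (finv_word u ++ u) [::].
Proof.
elim: u => [|a u IH]; first exact: feq_refl.
have h : feq [:: finv_letter a; a] [::].
  case: a => [x b|i a] /=; first by rewrite -{2}(negbK b); exact: feq_cancel.
  by apply: feq_trans (feq_mul _ _) _; rewrite mulVg; exact: feq_one.
rewrite /finv_word /= rev_cons cat_rcons.
exact: feq_trans (feq_cat (feq_refl _) (feq_cat h (feq_refl u))) IH.
Qed.
Lemma finvE u : finv (fclass u) = fclass (finv_word u).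
Proof. by apply/fclassP/feq_inv/fclassP; rewrite freprK. Qed.

Fact fmulA : associative fmul.
Proof.
move=> x y z; rewrite -(freprK x) -(freprK y) -(freprK z).
by rewrite !fmulE catA.
Qed.
Fact fmul1 : left_id (fclass [::]) fmul.
Proof. by move=> x; rewrite -(freprK x) fmulE. Qed.
Fact fmulg1 : right_id (fclass [::]) fmul.
Proof. by move=> x; rewrite -(freprK x) fmulE cats0. Qed.
Fact fmulV : left_inverse (fclass [::]) finv fmul.
Proof.
by move=> x; rewrite -(freprK x) finvE fmulE; apply/fclassP/feq_mulV.
Qed.
Fact fmulgV : right_inverse (fclass [::]) finv fmul.
Proof.
move=> x; rewrite -(freprK x) finvE fmulE; apply/fclassP.
set u := repr x; have /fclassP := feq_mulV (finv_word u).
suff -> : finv_word (finv_word u) = u by move/fclassP.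
rewrite /finv_word map_rev revK -map_comp -[RHS]map_id.
by apply: eq_map => -[y b|i a] /=; rewrite ?negbK ?invgK.
Qed.
HB.instance Definition _ :=
  isGroup.Build freeprod fmulA fmul1 fmulg1 fmulV fmulgV.

Definition fgen (x : T) : freeprod := fclass [:: FGen x true].
Definition felt i (a : A i) : freeprod := fclass [:: FElt a].

Fact felt_morph i : {morph @felt i : a b / a * b}.
Proof.
by move=> a b; rewrite /felt [RHS]fmulE; apply/fclassP/feq_sym/feq_mul.
Qed.
HB.instance Definition _ i :=
  isMultiplicative.Build (A i) freeprod (@felt i) (@felt_morph i).

Variables (G : groupType) (f : T -> G) (g : forall i, {multiplicative A i -> G}).

Definition feval_letter a : G :=
  match a with
  | FGen x b => if b then f x else (f x)^-1
  | FElt i a => g i a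
  end.
Definition feval (u : seq fletter) : G := \prod_(a <- u) feval_letter a.

(* The homomorphism to G extending f and all the g i. *)
Definition flift (x : freeprod) : G := feval (repr x).

Fact feq_eval u v : feq u v -> feval u = feval v.
Proof.
rewrite /feval; elim=> {u v}.
- by [].
- by move=> u v _.
- by move=> u v w _ -> _.
- by move=> u u' v v' _ hu _ hv; rewrite !big_cat /= hu hv.
- move=> x [] /=; rewrite !big_cons !big_nil /= mulg1 ?mulgV ?mulVg //.
- move=> i; rewrite big_cons !big_nil mulg1 /=.
  by apply: (mulgI (g i 1)); rewrite -gmulfM !mulg1.
- by move=> i a b; rewrite !big_cons !big_nil /= !mulg1 gmulfM.
Qed.
Lemma flift_class u : flift (fclass u) = feval u.
Proof. by apply/feq_eval/fclassP; rewrite freprK. Qed.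
Fact flift_morph : {morph flift : x y / x * y}.
Proof.
move=> x y; rewrite -(freprK x) -(freprK y) [_ * _]fmulE !flift_class.
by rewrite /feval big_cat.
Qed.
HB.instance Definition _ := isMultiplicative.Build freeprod G flift flift_morph.

Lemma flift_gen x : flift (fgen x) = f x.
Proof. by rewrite flift_class /feval big_seq1. Qed.
Lemma flift_elt i (a : A i) : flift (felt a) = g i a.
Proof. by rewrite flift_class /feval big_seq1. Qed.

Lemma flift_unique (h : {multiplicative freeprod -> G}) :
  (forall x, h (fgen x) = f x) -> (forall i (a : A i), h (felt a) = g i a) ->
  h =1 flift.
Proof.
move=> hgen helt x.
have h1 : h 1 = 1 by apply: (mulgI (h 1)); rewrite -gmulfM !mulg1.
rewrite -(freprK x) flift_class /feval; elim: (repr x) => [|a u IH].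
  by rewrite big_nil.
rewrite big_cons -cat1s -fmulE [h _]gmulfM IH; congr (_ * _).
case: a => [y b|i a]; last exact: helt.
case: b => //=; first exact: hgen.
apply: (mulgI (f y)); rewrite mulgV -hgen -gmulfM [_ * _]fmulE -h1.
by congr (h _); apply/fclassP/(feq_cancel y true).
Qed.
End FreeProduct.

Arguments fgen {T I} A x.
Arguments felt {T I A i} a.

Section RelativePresentations.
Variables (G : groupType) (I : Type) (S : I -> groupClosed G).

Definition rel_free (X : set G) : groupType :=
  freeprod (set_type X) (fun i => subgrp (S i)).

Definition rel_proj (X : set G) : {multiplicative rel_free X -> G} :=
  flift (fun x : set_type X => val x)
        (fun i => (val : subgrp (S i) -> G) : {multiplicative subgrp (S i) -> G}).

(* X is a symmetrized subset of G, and F(X) is literally free with basis X: in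
   [rel_free X] the basis elements x and x^-1 of X are unrelated, so the
   relation between them has to follow from the relators. *)
Record rel_presentation := RelPresentation {
  rp_gen : set G;
  rp_rel : set (rel_free rp_gen);
  rp_sym : forall x, rp_gen x -> rp_gen x^-1;
  rp_generated : generated (rp_gen `|` \bigcup_i [set` S i]) = setT;
  rp_kernel : [set w | rel_proj rp_gen w = 1] = normal_closure rp_rel }.

Definition finite_rel_presentation (P : rel_presentation) : Prop :=
  finite_set (rp_gen P) /\ finite_set (@rp_rel P).

Definition finitely_presented_rel : Prop :=
  exists P : rel_presentation, finite_rel_presentation P.

Section Dehn.
Variable P : rel_presentation.
Local Notation F := (rel_free (rp_gen P)).

(* X together with the disjoint union of the H_i \ {1}. *)
Definition rel_letter : Type :=
  (set_type (rp_gen P) + {i : I & {h : subgrp (S i) | h != 1}})%type.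

Definition letter_free (a : rel_letter) : F :=
  match a with
  | inl x => fgen _ x
  | inr (existT i h) => @felt (set_type (rp_gen P)) I (fun i => subgrp (S i)) i (val h)
  end.
Definition word_free (W : seq rel_letter) : F := \prod_(a <- W) letter_free a.

Definition word_value (W : seq rel_letter) : G := rel_proj _ (word_free W).

Definition conj_product (k : nat) (w : F) : Prop :=
  exists (f r : 'I_k -> F) (s : 'I_k -> bool), (forall i, rp_rel (r i)) /\
    w = \prod_(i < k) ((f i)^-1 * (if s i then r i else (r i)^-1) * f i).

Definition is_rel_area (W : seq rel_letter) (k : nat) : Prop :=
  conj_product k (word_free W) /\
  forall m, conj_product m (word_free W) -> (k <= m)%N.

Definition rel_isoperimetric (f : nat -> nat) : Prop :=
  forall (n : nat) (W : seq rel_letter), (size W <= n)%N -> word_value W = 1 ->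
    exists2 k, is_rel_area W k & (k <= f n)%N.

(* delta is the relative Dehn function of P; that the latter is well-defined
   means that such a delta exists. *)
Definition is_rel_dehn (delta : nat -> nat) : Prop :=
  rel_isoperimetric delta /\
  forall f, rel_isoperimetric f -> forall n, (delta n <= f n)%N.
End Dehn.
End RelativePresentations.

Definition fun_preceq (f g : nat -> nat) : Prop :=
  exists A B C : nat, [/\ (0 < A)%N, (0 < B)%N, (0 < C)%N &
    forall n, (f n <= A * g (B * n) + C * n)%N].

(* The number of summands is i.+1 <= n; the value at 0 is the empty maximum 0. *)
Definition superadditive_closure (f : nat -> nat) (n : nat) : nat :=
  (\max_(i < n) \max_(a : {ffun 'I_i.+1 -> 'I_n.+1} | \sum_j a j == n)
     \sum_j f (a j))%N.

(* K gets an index of its own, even when it coincides with some S i. *)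
Definition adjoin (G : groupType) (I : Type) (S : I -> groupClosed G)
    (K : groupClosed G) (o : option I) : groupClosed G :=
  if o is Some i then S i else K.

Section HNN.
Variables (H : groupType) (K L : groupClosed H) (iota : subgrp K -> subgrp L).

(* The free product of H and the infinite cyclic group generated by t. *)
Definition hnn_free : groupType := freeprod unit (fun _ : unit => H).
Definition hnn_incl (h : H) : hnn_free := @felt unit unit (fun=> H) tt h.
Definition hnn_t : hnn_free := fgen (fun _ : unit => H) tt.

Definition hnn_relators : set hnn_free :=
  [set r | exists k : subgrp K,
     r = hnn_t^-1 * hnn_incl (val k) * hnn_t * (hnn_incl (val (iota k)))^-1].

(* < H, t | t^-1 k t = iota k, k in K > *)
Definition HNN : groupType := add_relations hnn_relators.

Definition hnn_base (h : H) : HNN := qproj hnn_relators (hnn_incl h).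
Fact hnn_base_morph : {morph hnn_base : x y / x * y}.
Proof. by move=> x y; rewrite /hnn_base /hnn_incl !gmulfM. Qed.
HB.instance Definition _ := isMultiplicative.Build H HNN hnn_base hnn_base_morph.
End HNN.

(* Main.v *)
(* Substituting t iota(k) t^-1 for the letters k of
   K in the relators of H gives a finite relative presentation of G: since iota
   is a homomorphism to some H_nu, products in K cost nothing. A word of value 1
   over X, the H_l, K and t^{+-1} either contains no t or, by Britton's lemma,
   contains t^-1 u t with u = k in K or t u t^-1 with u = iota(k), u a word in
   the letters of H. Replacing this subword by the single letter iota(k),
   resp. k, costs the area of a word of length |u| + 1 of value 1 in H and
   shortens the word by |u| + 1, so by superadditivity the total cost is
   at most a constant times the superadditive closure of gamma at the length
   of the word. *)
Require Import Defs.
From HB Require Import structures.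
From mathcomp Require Import all_boot zify.
From mathcomp Require Import boolp classical_sets cardinality.

Set Implicit Arguments.
Unset Strict Implicit.
Unset Printing Implicit Defensive.

Local Open Scope group_scope.

(** * Homomorphisms, and induction over generated subgroups, normal closures and free products *)

Section Morphisms.
Variables (G G' : groupType) (f : {multiplicative G -> G'}).

Lemma morph1 : f 1 = 1.
Proof. by apply: (mulgI (f 1)); rewrite -gmulfM !mulg1. Qed.

Lemma morphV : {morph f : x / x^-1}.
Proof. by move=> x; apply: (mulgI (f x)); rewrite -gmulfM !mulgV morph1. Qed.

Lemma morphJ : {morph f : x y / x ^ y}.
Proof. by move=> x y; rewrite !conjgE !gmulfM morphV. Qed.

Lemma morph_prod (T : Type) (s : seq T) (F : T -> G) :
  f (\prod_(a <- s) F a) = \prod_(a <- s) f (F a).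
Proof.
by elim: s => [|a s IH]; rewrite ?big_nil ?morph1 // !big_cons gmulfM IH.
Qed.
End Morphisms.

(** Bundling an arbitrary closed [Prop] turns the impredicative definitions of generated subgroup
    and normal closure into induction principles. *)
Lemma groupClosed_of (G : groupType) (N : G -> Prop) :
  N 1 -> (forall x y, N x -> N y -> N (x * y)) -> (forall x, N x -> N x^-1) ->
  exists M : groupClosed G, forall g, g \in M <-> N g.
Proof.
move=> N1 NM NV; pose p : {pred G} := fun g => `[< N g >].
have pP g : g \in p <-> N g by split=> /asboolP.
have pM : mulg_closed p by move=> x y /pP Nx /pP Ny; apply/pP/NM.
have pV : invg_closed p by move=> x /pP Nx; apply/pP/NV.
have p1 : 1 \in p by apply/pP.
pose i1 := isMulClosed.Build G p pM.
pose i2 := isMul1Closed.Build G p p1.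
pose i3 := isInvClosed.Build G p pV.
pose M : groupClosed G := HB.pack p i1 i2 i3.
by exists M.
Qed.

Lemma generated_ind (G : groupType) (A : set G) (N : G -> Prop) :
  N 1 -> (forall x y, N x -> N y -> N (x * y)) -> (forall x, N x -> N x^-1) ->
  (forall a, A a -> N a) -> forall g, generated A g -> N g.
Proof.
move=> N1 NM NV AN g gA; have [M MN] := groupClosed_of N1 NM NV.
by apply/MN/gA => a /AN /MN.
Qed.

Lemma generated_setT (G : groupType) (A : set G) :
  (forall N : G -> Prop, N 1 -> (forall x y, N x -> N y -> N (x * y)) ->
     (forall x, N x -> N x^-1) -> (forall a, A a -> N a) -> forall g, N g) ->
  generated A = setT.
Proof.
move=> h; apply/seteqP; split=> // g _ M AM.
by apply: (h (fun g => g \in M)) => //;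
  [exact: gpred1 | exact: gpredM | exact: gpredVr].
Qed.

Lemma normal_closure_ind (G : groupType) (R : set G) (N : G -> Prop) :
  N 1 -> (forall x y, N x -> N y -> N (x * y)) -> (forall x, N x -> N x^-1) ->
  (forall x g, N x -> N (x ^ g)) -> (forall r, R r -> N r) ->
  forall g, normal_closure R g -> N g.
Proof.
move=> N1 NM NV NJ RN g gR; have [M MN] := groupClosed_of N1 NM NV.
by apply/MN/gR => [x y /MN xN|r /RN /MN //]; apply/MN/NJ.
Qed.

Lemma normal_closure_morph (G G' : groupType) (R : set G)
    (f : {multiplicative G -> G'}) :
  (forall r, R r -> f r = 1) -> forall g, normal_closure R g -> f g = 1.
Proof.
move=> fR; apply: normal_closure_ind => //.
- exact: morph1.
- by move=> x y fx fy; rewrite gmulfM fx fy mulg1.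
- by move=> x fx; rewrite morphV fx invg1.
- by move=> x g fx; rewrite morphJ fx conj1g.
Qed.

(** Two preimages under [p] differ by an element of its kernel, which [f] kills, so [f] composed
    with any section of [p] works. *)
Lemma factor_morph (F G G' : groupType) (p : {multiplicative F -> G})
    (f : {multiplicative F -> G'}) :
  (forall g, exists x, p x = g) -> (forall x, p x = 1 -> f x = 1) ->
  exists h : {multiplicative G -> G'}, forall x, h (p x) = f x.
Proof.
move=> /choice[s sK] pf; pose h g := f (s g).
have hp x : h (p x) = f x.
  apply: (mulgI (f x)^-1); rewrite mulVg -morphV -gmulfM; apply: pf.
  by rewrite gmulfM morphV sK mulVg.
have hM : {morph h : x y / x * y}.
  by move=> x y; rewrite -{1}(sK x) -{1}(sK y) -gmulfM hp gmulfM.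
pose i := isMultiplicative.Build G G' h hM.
pose H : {multiplicative G -> G'} := HB.pack h i.
by exists H.
Qed.

Lemma freeprod_ext (T I : Type) (A : I -> groupType) (G : groupType)
    (h1 h2 : {multiplicative freeprod T A -> G}) :
  (forall x, h1 (fgen A x) = h2 (fgen A x)) ->
  (forall i (a : A i), h1 (felt a) = h2 (felt a)) -> h1 =1 h2.
Proof.
move=> hgen helt x.
pose g i : {multiplicative A i -> G} := h2 \o @felt T I A i.
rewrite (@flift_unique _ _ _ _ (fun x => h2 (fgen A x)) g h1) //.
by rewrite (@flift_unique _ _ _ _ (fun x => h2 (fgen A x)) g h2).
Qed.

Lemma fclass_prod (T I : Type) (A : I -> groupType) (u : seq (fletter T A)) :
  fclass u = \prod_(a <- u) fclass [:: a].
Proof.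
elim: u => [|a u IH]; first by rewrite big_nil.
by rewrite big_cons -IH -cat1s -fmulE.
Qed.

Lemma freeprod_ind (T I : Type) (A : I -> groupType) (N : freeprod T A -> Prop) :
  N 1 -> (forall x y, N x -> N y -> N (x * y)) ->
  (forall x, N x -> N x^-1) ->
  (forall x, N (fgen A x)) -> (forall i (a : A i), N (felt a)) ->
  forall x, N x.
Proof.
move=> N1 NM NV Ngen Nelt x; rewrite -(freprK x).
elim: (repr x) => [//|a u IH]; rewrite -cat1s -fmulE; apply: NM => //.
case: a => [y [] | i a]; [exact: Ngen | | exact: Nelt].
have -> : fclass [:: FGen A y false] = (fgen A y)^-1 by rewrite [RHS]finvE.
exact: NV.
Qed.

(** * Products of boundedly many conjugates of relators *)

Section Area.
Variables (F : groupType) (R : set F).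

(* [area k w]: w is a product of at most k conjugates of elements of R^{+-1}. *)
Inductive area : nat -> F -> Prop :=
| area0 : area 0 1
| areaW k w : area k w -> area k.+1 w
| areaS k w f r (b : bool) : R r -> area k w ->
    area k.+1 (w * (f^-1 * (if b then r else r^-1) * f)).

Lemma area_leq m n w : (m <= n)%N -> area m w -> area n w.
Proof.
move=> /subnK <- aw; elim: (n - m)%N => [//|k IH].
by rewrite addSn; exact: areaW.
Qed.

Lemma areaM m n v w : area m v -> area n w -> area (m + n) (v * w).
Proof.
move=> av; elim=> {n w} [|n w _ IH|n w f r b Rr _ IH].
- by rewrite addn0 mulg1.
- by rewrite addnS; exact: areaW.
- by rewrite addnS mulgA; exact: areaS.
Qed.

Lemma area_rel f r (b : bool) : R r -> area 1 (f^-1 * (if b then r else r^-1) * f).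
Proof. by move=> Rr; rewrite -[_ * f]mul1g; exact: (areaS f b Rr area0). Qed.

Lemma areaV n w : area n w -> area n w^-1.
Proof.
elim=> {n w} [|n w _ IH|n w f r b Rr _ IH].
- by rewrite invg1; exact: area0.
- exact: areaW.
- rewrite invgM -add1n; apply: areaM => //.
  have -> : (f^-1 * (if b then r else r^-1) * f)^-1
      = f^-1 * (if ~~ b then r else r^-1) * f.
    by case: b; rewrite !invgM !invgK mulgA.
  exact: area_rel.
Qed.

Lemma areaJ n w g : area n w -> area n (w ^ g).
Proof.
elim=> {n w} [|n w _ IH|n w f r b Rr _ IH].
- by rewrite conj1g; exact: area0.
- exact: areaW.
- have -> : (w * (f^-1 * (if b then r else r^-1) * f)) ^ g
     = w ^ g * ((f * g)^-1 * (if b then r else r^-1) * (f * g)).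
    by rewrite conjMg !conjgE invgM !mulgA.
  exact: areaS.
Qed.

Lemma normal_closure_area w : normal_closure R w -> exists n, area n w.
Proof.
move: w; apply: normal_closure_ind.
- by exists 0; exact: area0.
- by move=> x y [m ax] [n ay]; exists (m + n)%N; exact: areaM.
- by move=> x [n ax]; exists n; exact: areaV.
- by move=> x g [n ax]; exists n; exact: areaJ.
- move=> r Rr; exists 1%N; have := area_rel 1 true Rr.
  by rewrite invg1 mul1g mulg1.
Qed.

Lemma area_normal_closure n w : area n w -> normal_closure R w.
Proof.
move=> aw M nM RM; elim: aw => {n w} [|n w _ //|n w f r b /RM rM _ wM].
  exact: gpred1.
apply: gpredM => //; rewrite -mulgA; apply: nM.
by case: b => //; rewrite gpredV.
Qed.
End Area.

Lemma area_morph (F F' : groupType) (R : set F) (R' : set F')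
    (f : {multiplicative F -> F'}) C :
  (forall r, R r -> area R' C (f r)) ->
  forall n w, area R n w -> area R' (C * n) (f w).
Proof.
move=> fR n w; elim=> {n w} [|n w _ IH|n w g r b Rr _ IH].
- by rewrite muln0 morph1; exact: area0.
- by apply: area_leq IH; rewrite leq_mul2l leqnSn orbT.
- rewrite gmulfM mulnS addnC; apply: areaM => //.
  rewrite !gmulfM morphV -mulgA; apply: areaJ.
  by case: b; rewrite ?morphV; [|apply: areaV]; exact: fR.
Qed.

(** [conj_product] demands exactly [k] factors while [area] only bounds their number, hence the
    slack [k <= n]. *)
Lemma conj_productP (G : groupType) (I : Type) (S : I -> groupClosed G)
    (P : rel_presentation S) n (w : rel_free S (rp_gen P)) :
  area (rp_rel (r:=P)) n w <-> exists2 k, (k <= n)%N & conj_product k w.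
Proof.
split.
  elim=> {n w} [|n w _ [k kn cw]|n w g r b Rr _ [k kn [f [rr [s [Rrr ->]]]]]].
  - exists 0 => //; exists (fun=> 1), (fun=> 1), (fun=> true).
    by split=> [[]//|]; rewrite big_ord0.
  - by exists k => //; exact: leqW.
  (* [ext] prolongs a family on ['I_k] by the value [x] at the last index. *)
  - pose ext (T : Type) (a : 'I_k -> T) x (i : 'I_k.+1) :=
      if unlift ord_max i is Some j then a j else x.
    have ext_w T a x (i : 'I_k) : ext T a x (widen_ord (leqnSn k) i) = a i.
      rewrite /ext; have -> : widen_ord (leqnSn k) i = lift ord_max i.
        by apply: val_inj => /=; rewrite /bump leqNgt ltn_ord add0n.
      by rewrite liftK.
    have ext_m T a x : ext T a x ord_max = x by rewrite /ext unlift_none.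
    exists k.+1 => //; exists (ext _ f g), (ext _ rr r), (ext _ s b); split.
      by move=> i; rewrite /ext; case: unlift.
    rewrite big_ord_recr /= !ext_m; congr (_ * _).
    by apply: eq_bigr => i _; rewrite !ext_w.
move=> [k kn cw]; apply: (area_leq kn) => {n kn}.
have [f [r [s [Rr ->]]]] := cw => {w cw}.
elim: k => [|k IH] in f r s Rr *; first by rewrite big_ord0; exact: area0.
by rewrite big_ord_recr /=; apply: areaS => //; apply: IH.
Qed.

(** By monotonicity the maximum of the individual bounds is uniform. This supplies the constants
    attached to finite sets of relators and generators. *)
Lemma finite_uniform_bound (T : choiceType) (A : set T) (N : nat -> T -> Prop) :
  finite_set A -> (forall m n x, (m <= n)%N -> N m x -> N n x) ->
  (forall x, A x -> exists n, N n x) -> exists n, forall x, A x -> N n x.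
Proof.
move=> /finite_seqP[s ->] Nmono sN.
have {sN}: forall x, x \in s -> exists n, N n x by move=> x xs; exact: sN.
elim: s => [_|a s IH sN]; first by exists 0.
have [|m sm] := IH; first by move=> x xs; apply: sN; rewrite in_cons xs orbT.
have [k ak] := sN a (mem_head _ _).
exists (maxn m k) => x /=; rewrite in_cons => /predU1P[->|xs].
  exact: Nmono (leq_maxr _ _) ak.
exact: Nmono (leq_maxl _ _) (sm x xs).
Qed.

(** * Superadditive closure *)

Lemma leq_sumn (s : seq nat) x : x \in s -> (x <= sumn s)%N.
Proof.
elim: s => [//|y s IH]; rewrite in_cons => /predU1P[->|/IH xs] /=.
  exact: leq_addr.
exact: leq_trans xs (leq_addl _ _).
Qed.

Section SuperadditiveClosure.
Variable f : nat -> nat.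
Local Notation fbar := (superadditive_closure f).

(** Padding [s] with ones up to total [n] gives an admissible decomposition: [size s <= sumn s]
    keeps the number of summands at most [n]. *)
Lemma superadditive_closure_ge (s : seq nat) n :
  (size s <= sumn s)%N -> (sumn s <= n)%N -> (\sum_(x <- s) f x <= fbar n)%N.
Proof.
move=> ss sn; case: (posnP n) => [n0|n_gt0].
  have /nilP-> : nilp s by move: sn ss; rewrite n0 leqn0 => /eqP->; rewrite leqn0.
  by rewrite big_nil.
pose s' := s ++ nseq (n - sumn s) 1%N.
have sum_s' : sumn s' = n by rewrite sumn_cat sumn_nseq mul1n subnKC.
have size_s' : (size s' <= n)%N by rewrite size_cat size_nseq; lia.
have size_gt0 : (0 < size s')%N.
  by rewrite lt0n; apply/negP => /nilP s'0; rewrite -sum_s' s'0 in n_gt0.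
apply: (@leq_trans (\sum_(x <- s') f x)); first by rewrite big_cat leq_addr.
pose i := (size s').-1; have iE : i.+1 = size s' by rewrite prednK.
have i_n : (i < n)%N by rewrite iE.
pose a : {ffun 'I_i.+1 -> 'I_n.+1} := [ffun j : 'I_i.+1 => inord (nth 0 s' j)].
have aE j : a j = nth 0 s' j :> nat.
  by rewrite ffunE inordK // ltnS -sum_s' leq_sumn // mem_nth // -iE.
have sum_a (g : nat -> nat) : (\sum_j g (a j) = \sum_(x <- s') g x)%N.
  rewrite (big_nth 0) -iE big_mkord.
  by apply: eq_bigr => j _; rewrite aE.
apply: (bigmax_sup (Ordinal i_n)) => //.
apply: (bigmax_sup a); last by rewrite sum_a.
by rewrite (sum_a id) -sum_s' sumnE.
Qed.

(** With lists as witnesses, superadditivity reduces to concatenating optimal decompositions. *)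
Lemma superadditive_closure_attained n :
  exists s : seq nat, [/\ (size s <= sumn s)%N, (sumn s <= n)%N &
    (fbar n <= \sum_(x <- s) f x)%N].
Proof.
pose Q v := exists s : seq nat, [/\ (size s <= sumn s)%N, (sumn s <= n)%N &
    (v <= \sum_(x <- s) f x)%N].
have Q0 : Q 0 by exists [::].
have Qmax x y : Q x -> Q y -> Q (maxn x y) by rewrite /maxn; case: ifP.
rewrite -/(Q _) /superadditive_closure; apply: (big_ind Q) => // i _.
apply: (big_ind Q) => // a /eqP sum_a.
exists [seq nat_of_ord (a j) | j <- enum 'I_i.+1].
have sumE (g : nat -> nat) :
    (\sum_(x <- [seq nat_of_ord (a j) | j <- enum 'I_i.+1]) g x = \sum_j g (a j))%N.
  by rewrite big_map big_enum.
by rewrite sumnE !sumE sum_a size_map -cardE card_ord ltn_ord leqnn.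
Qed.

Lemma superadditive_closureD m n : (fbar m + fbar n <= fbar (m + n))%N.
Proof.
have [s [ss sm sf]] := superadditive_closure_attained m.
have [s' [ss' sn' sf']] := superadditive_closure_attained n.
apply: leq_trans (leq_add sf sf') _; rewrite -big_cat.
apply: superadditive_closure_ge; first by rewrite size_cat sumn_cat leq_add.
by rewrite sumn_cat leq_add.
Qed.

Lemma superadditive_closure_leq m n : (m <= n)%N -> (fbar m <= fbar n)%N.
Proof.
by move=> /subnKC <-; apply: leq_trans (superadditive_closureD _ _); exact: leq_addr.
Qed.

(** The one-term sum is admissible only for positive [n]: at 0 the closure is the empty maximum 0,
    whatever [f 0] is. *)
Lemma leq_superadditive_closure n : (0 < n)%N -> (f n <= fbar n)%N.
Proof.
move=> n_gt0; have := @superadditive_closure_ge [:: n] n.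
by rewrite big_seq1 /= addn0 leqnn; apply.
Qed.

Lemma superadditive_closureM k n : (k * fbar n <= fbar (k * n))%N.
Proof.
elim: k => [//|k IH]; rewrite !mulSn; apply: leq_trans (superadditive_closureD _ _).
by rewrite leq_add2l.
Qed.

(* If fbar m > 0, then superadditivity gives n <= fbar (n * m). *)
Lemma superadditive_closure_comp :
  exists2 m, (0 < m)%N & forall n, (fbar n <= fbar (fbar (m * n)))%N.
Proof.
have [f0|/existsNP[m /eqP fm]] := pselect (forall m, fbar m = 0).
  by exists 1%N => // n; rewrite f0.
exists m => [|n].
  by rewrite lt0n; apply: contra fm => /eqP->; rewrite /superadditive_closure big_ord0.
apply/superadditive_closure_leq/(@leq_trans (n * fbar m)); last first.
  by rewrite (mulnC m) superadditive_closureM.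
by rewrite leq_pmulr // lt0n.
Qed.
End SuperadditiveClosure.

(** * Normal forms in HNN-extensions and Britton's lemma *)

Section NormalForm.
Variables (H : groupType) (K L : groupClosed H).
Variables (iota : {multiplicative subgrp K -> subgrp L}).
Hypothesis iota_inj : injective iota.

(* a t^e = t^e b, where t^true is t and t^false is t^-1. *)
Definition assoc (e : bool) (a b : H) : Prop := exists k : subgrp K,
  if e then a = val k /\ b = val (iota k) else a = val (iota k) /\ b = val k.

Lemma assocN e a b : assoc (~~ e) b a <-> assoc e a b.
Proof. by case: e; split=> -[k [-> ->]]; exists k. Qed.

(** Injectivity of [iota] enters here: for [e = false] it recovers [k] from [iota k]. *)
Lemma assoc_uniq e a b b' : assoc e a b -> assoc e a b' -> b = b'.
Proof.
case: e => -[k [-> ->]] [k' [kk' ->]]; first by rewrite (val_inj kk').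
by rewrite (iota_inj (val_inj kk')).
Qed.

Lemma assocM e a b a' b' : assoc e a b -> assoc e a' b' -> assoc e (a * a') (b * b').
Proof.
by case: e => -[k [-> ->]] [k' [-> ->]]; exists (k * k'); rewrite (gmulfM (s := iota)) !valM.
Qed.

Lemma subgrp_valV (S : groupClosed H) (k : subgrp S) : val k^-1 = (val k)^-1.
Proof. exact: (@morphV _ _ (val : {multiplicative subgrp S -> H})). Qed.

Lemma subgrp_val1 (S : groupClosed H) : val (1 : subgrp S) = 1.
Proof. exact: (@morph1 _ _ (val : {multiplicative subgrp S -> H})). Qed.

Lemma assocV e a b : assoc e a b -> assoc e a^-1 b^-1.
Proof.
by case: e => -[k [-> ->]]; exists k^-1; rewrite (morphV iota) !subgrp_valV.
Qed.

Lemma assoc1 e : assoc e 1 1.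
Proof. by exists 1; case: e; rewrite (morph1 iota) !subgrp_val1. Qed.

(** A transversal of the left cosets of [K] ([e = true]) or of the image of [iota] ([e = false]), in
    which the subgroup itself is represented by 1. *)
Definition coset_rep e h : H :=
  if `[< exists b, assoc e h b >] then 1
  else xget 1 [set x | exists b, assoc e (x^-1 * h) b]%classic.

(** The [b] in the rewriting [h t^e = r t^e b], where [r] represents the coset of [h]. *)
Definition coset_part e h : H :=
  xget 1 [set b | assoc e ((coset_rep e h)^-1 * h) b]%classic.

Lemma coset_partP e h : assoc e ((coset_rep e h)^-1 * h) (coset_part e h).
Proof.
rewrite /coset_part; case: xgetP => [b -> //|] no; exfalso.
have: exists b, assoc e ((coset_rep e h)^-1 * h) b.
  rewrite /coset_rep; case: asboolP; first by rewrite invg1 mul1g.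
  move=> _; case: xgetP => [x -> //|/(_ h) []]; exists 1.
  by rewrite mulVg; exact: assoc1.
by move=> [b /no].
Qed.

(** Both elements define the same coset, so [xget] is applied to the same set and makes the same
    choice. *)
Lemma coset_repM e h a b : assoc e a b -> coset_rep e (h * a) = coset_rep e h.
Proof.
move=> ab; rewrite /coset_rep.
have hE x : (exists c, assoc e (x * (h * a)) c) = (exists c, assoc e (x * h) c).
  apply/propext; split=> -[c xc]; last by exists (c * b); rewrite mulgA; exact: assocM.
  by exists (c * b^-1); have := assocM xc (assocV ab); rewrite mulgA mulgK.
have := hE 1; rewrite !mul1g => ->; congr (if _ then _ else _).
by congr xget; apply/seteqP; split=> x /=; rewrite hE.
Qed.

Lemma coset_partM e h a b : assoc e a b -> coset_part e (h * a) = coset_part e h * b.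
Proof.
move=> ab; apply: assoc_uniq (coset_partP e (h * a)) _.
by rewrite (coset_repM h ab) mulgA; exact: assocM (coset_partP e h) ab.
Qed.

Lemma coset_rep_assoc e a b : assoc e a b -> coset_rep e a = 1.
Proof.
by move=> ab; rewrite /coset_rep; case: asboolP => // -[]; exists b.
Qed.

Lemma coset_part_assoc e a b : assoc e a b -> coset_part e a = b.
Proof.
move=> ab; apply: assoc_uniq (coset_partP e a) _.
by rewrite (coset_rep_assoc ab) invg1 mul1g.
Qed.

Lemma coset_rep_id e h : coset_rep e (coset_rep e h) = coset_rep e h.
Proof.
have := coset_repM (coset_rep e h) (coset_partP e h).
by rewrite mulVKg => <-.
Qed.

(* The pair ([:: (r_n, e_n); ...; (r_1, e_1)], h) stands for the normal form
   r_1 t^e_1 ... r_n t^e_n h. *)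
Definition state := (seq (H * bool) * H)%type.

Fixpoint reduced (s : seq (H * bool)) : bool :=
  if s is (r, e) :: s' then
    [&& coset_rep e r == r,
        (if s' is (_, e') :: _ then ~~ ((r == 1) && (e' == ~~ e)) else true)
      & reduced s']
  else true.

(** Right multiplication of a normal form by [t^e]: rewrite [h t^e] as [r t^e b]; if [r = 1] and the
    preceding stable letter is [t^-e], the two cancel and [b] joins the coefficient before them. *)
Definition push (e : bool) (st : state) : state :=
  let: (s, h) := st in
  if s is (r', e') :: s' then
    if (coset_rep e h == 1) && (e' == ~~ e) then (s', r' * coset_part e h)
    else ((coset_rep e h, e) :: s, coset_part e h)
  else ((coset_rep e h, e) :: s, coset_part e h).

Definition mul_state (st : state) (g : H) : state := (st.1, st.2 * g).

Lemma push_reduced e st : reduced st.1 -> reduced (push e st).1.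
Proof.
case: st => -[|[r' e'] s] h /=; first by rewrite coset_rep_id eqxx.
move=> red; case: ifP => [_|] /=; first by case/and3P: red.
by move=> -> /=; rewrite coset_rep_id eqxx.
Qed.

Lemma push_mul e st a b :
  assoc e a b -> push e (mul_state st a) = mul_state (push e st) b.
Proof.
move=> ab; case: st => -[|[r' e'] s] h;
  rewrite /mul_state /= (coset_repM h ab) (coset_partM h ab) //.
by case: ifP; rewrite //= mulgA.
Qed.

(** If the first push adds a syllable, the second removes it. If it cancels one, the second restores
    it, because the coefficient was a representative and the remaining form is reduced. *)
Lemma pushK e st : reduced st.1 -> push (~~ e) (push e st) = st.
Proof.
case: st => s h; have part := coset_partP e h; have part' := (assocN e _ _).2 part.
have popped : push (~~ e) ((coset_rep e h, e) :: s, coset_part e h) = (s, h).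
  rewrite /= (coset_rep_assoc part') (coset_part_assoc part') eqxx negbK eqxx /=.
  by rewrite mulVKg.
case: s popped => [//|[r' e'] s] popped /and3P[/eqP r'E top _].
rewrite [push e _]/=; case: ifP => [/andP[/eqP h1 /eqP e'E]|_]; last exact: popped.
rewrite h1 invg1 mul1g in part'; rewrite e'E in r'E top *.
rewrite /= (coset_repM _ part') (coset_partM _ part') r'E.
have -> : coset_part (~~ e) r' = 1.
  apply: assoc_uniq (coset_partP (~~ e) r') _.
  by rewrite r'E mulVg; exact: assoc1.
by case: s top {popped} => [|[r'' e''] s] => [_|/negbTE ->]; rewrite mul1g.
Qed.

Local Notation letter := (fletter unit (fun _ : unit => H)).

Definition hnn_letter (a : H + bool) : letter :=
  match a with inl h => @FElt unit unit (fun=> H) tt h | inr e => FGen (fun=> H) tt e end.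

Definition act_letter (st : state) (a : letter) : state :=
  match a with FGen _ e => push e st | FElt _ g => mul_state st g end.
Definition act (st : state) (u : seq letter) : state := foldl act_letter st u.

Lemma act_reduced u st : reduced st.1 -> reduced (act st u).1.
Proof.
elim: u st => [//|[x e|i g] u IH] st red /=; apply: IH => //.
exact: push_reduced.
Qed.

Lemma act_feq u v : feq u v -> forall st, reduced st.1 -> act st u = act st v.
Proof.
elim=> {u v}.
- by [].
- by move=> u v _ uv st red; rewrite uv.
- by move=> u v w _ uv _ vw st red; rewrite uv ?vw.
- move=> u u' v v' _ uu' _ vv' st red; rewrite /act !foldl_cat -!/(act _ _) uu' //.
  exact/vv'/act_reduced.
- by move=> x b st red; exact: pushK.
- by move=> i [s h] _; rewrite /= /mul_state /= mulg1.
- by move=> i a b [s h] _; rewrite /= /mul_state /= mulgA.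
Qed.

(** The free product acts on reduced normal forms and the relators fix each of them, so the action
    descends to the HNN-extension. *)
Lemma act_relation u st :
  qproj (hnn_relators iota) (fclass u) = 1 -> reduced st.1 -> act st u = st.
Proof.
pose A (x : hnn_free H) st := act st (repr x).
have AE v st' : reduced st'.1 -> A (fclass v) st' = act st' v.
  by move=> red; apply: act_feq => //; apply/fclassP; rewrite freprK.
have AM x y st' : reduced st'.1 -> A (x * y) st' = A y (A x st').
  move=> red; rewrite -{1}(freprK x) -{1}(freprK y) [_ * _]fmulE AE //.
  by rewrite /act foldl_cat.
have A1 st' : reduced st'.1 -> A 1 st' = st' by move=> red; rewrite AE.
have Ared x st' : reduced st'.1 -> reduced (A x st').1 by exact: act_reduced.
move=> /esym /qprojP; rewrite invg1 mul1g => u1 red; rewrite -AE //.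
move: (fclass u) u1 st red; apply: normal_closure_ind => //.
- by move=> x y xA yA st red; rewrite AM // xA // yA.
- by move=> x xA st red; rewrite -{1}(xA st) // -AM // mulgV A1.
- move=> x g xA st red; rewrite conjgE !AM ?xA -?AM ?mulVg ?A1 //; try exact: Ared.
move=> _ [k ->] st red.
have -> : (hnn_t H)^-1 * hnn_incl (val k) * hnn_t H * (hnn_incl (val (iota k)))^-1 =
    fclass (map hnn_letter [:: inr false; inl (val k); inr true; inl (val (iota k))^-1]).
  have -> : (hnn_t H)^-1 = fclass [:: hnn_letter (inr false)] by rewrite [LHS]finvE.
  have -> : (hnn_incl (val (iota k)))^-1 = fclass [:: hnn_letter (inl (val (iota k))^-1)].
    by rewrite [LHS]finvE.
  by rewrite [RHS]fclass_prod big_map !big_cons big_nil mulg1 !mulgA.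
have ka : assoc true (val k) (val (iota k)) by exists k.
rewrite AE // -[act _ _]/(mul_state (push true (mul_state (push false st) (val k))) _).
(* Carried through [t], the factor [k] becomes [iota k], which the last letter of the relator
   cancels. *)
rewrite (push_mul _ ka) (pushK false) //.
by case: st {red} => s h; rewrite /mul_state /= mulgK.
Qed.

Definition stable_letter : HNN iota := qproj (hnn_relators iota) (hnn_t H).
Definition signed (G : groupType) (t : G) (e : bool) : G := if e then t else t^-1.

(** * Britton's lemma *)

Section Britton.
Variables (D : Type) (hv : D -> H).

Definition base_value (u : seq D) : H := \prod_(d <- u) hv d.

Definition hnn_value (W : seq (D + bool)) : HNN iota :=
  \prod_(a <- W)
    match a with inl d => hnn_base iota (hv d) | inr e => signed stable_letter e end.

Let to_letter (a : D + bool) : letter :=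
  hnn_letter (match a with inl d => inl (hv d) | inr e => inr e end).

Lemma hnn_value_class W :
  hnn_value W = qproj (hnn_relators iota) (fclass (map to_letter W)).
Proof.
rewrite fclass_prod big_map morph_prod /hnn_value.
apply: eq_bigr => -[d|[]] _ //=.
by rewrite /signed /stable_letter -morphV [_^-1]finvE.
Qed.

Lemma base_value_rcons u d : base_value (rcons u d) = base_value u * hv d.
Proof. by rewrite /base_value -cats1 big_cat big_seq1. Qed.

Definition pinched (W : seq (D + bool)) : Prop := exists e p u q b,
  W = p ++ inr (~~ e) :: map inl u ++ inr e :: q /\ assoc e (base_value u) b.

(** Without a pinch no stable letter is ever cancelled, so the last one of [W] stays at the head of
    the state. The factor [a] is the coset part left by its push. *)
Lemma act_unpinched W : ~ pinched W ->
  let st := act ([::], 1) (map to_letter W) in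
  (exists2 u, W = map inl u & st = ([::], base_value u)) \/
  (exists p e u r s a b, [/\ W = p ++ inr e :: map inl u, assoc (~~ e) a b
     & st = ((r, e) :: s, a * base_value u)]).
Proof.
elim/last_ind: W => [|W a IH] noP /=.
  by left; exists [::] => //; rewrite /base_value big_nil.
have notP : ~ pinched W.
  move=> [e [p [u [q [b [WE ab]]]]]]; apply: noP.
  exists e, p, u, (rcons q a), b; split=> //.
  by rewrite WE rcons_cat rcons_cons rcons_cat rcons_cons.
rewrite /= map_rcons /act foldl_rcons -/(act _ _).
move: {IH notP}(IH notP) => /=; case: a noP => [d|e] noP [[u WE ->]|[p [e' [u [r [s [a [b [WE ab ->]]]]]]]]].
- left; exists (rcons u d); first by rewrite WE map_rcons.
  by rewrite /= /mul_state base_value_rcons.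
- right; exists p, e', (rcons u d), r, s, a, b; split=> //.
    by rewrite WE rcons_cat map_rcons.
  by rewrite /= /mul_state base_value_rcons mulgA.
- right; exists W, e, [::], (coset_rep e (base_value u)), [::].
  exists (coset_part e (base_value u)), ((coset_rep e (base_value u))^-1 * base_value u).
  split; [by rewrite -cats1 | exact/assocN/coset_partP |].
  by rewrite /base_value big_nil mulg1.
- right; set h := a * base_value u.
  exists W, e, [::], (coset_rep e h), ((r, e') :: s), (coset_part e h).
  exists ((coset_rep e h)^-1 * h); split.
  + by rewrite -cats1.
  + exact/assocN/coset_partP.
  have -> : base_value [::] = 1 by rewrite /base_value big_nil.
  rewrite /= mulg1 -/h; case: ifP => // /andP[/eqP h1 /eqP e'E].
  (* A cancellation would put [a * base_value u] in the associated subgroup, which contains [a];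
     hence [u] has its value there and the new letter completes a pinch. *)
  case: noP; rewrite e'E negbK in ab.
  have := assocM (assocV ab) (coset_partP e h).
  rewrite h1 invg1 mul1g mulKg => uP.
  by exists e, p, u, [::], (b^-1 * coset_part e h); rewrite WE e'E -cats1 -catA.
Qed.

(** A word of value 1 fixes the empty normal form, whereas an unpinched word with a stable letter
    sends it to a nonempty one. *)
Lemma britton W : hnn_value W = 1 ->
  pinched W \/ (exists2 u, W = map inl u & base_value u = 1).
Proof.
rewrite hnn_value_class => /(@act_relation _ ([::], 1))/(_ isT) actW.
have [|/act_unpinched] := pselect (pinched W); first by left.
rewrite /= actW => -[[u -> [u1]]|[p [e [u [r [s [a [b [_ _ //]]]]]]]]].
by right; exists u.
Qed.
End Britton.
End NormalForm.

(** * Words and relative presentations *)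

Definition set_elt (T : Type) (A : set T) a (Aa : A a) : set_type A :=
  exist (fun x => x \in A) a (mem_set Aa).

Section WordValues.
Variables (G : groupType) (I : Type) (S : I -> groupClosed G).
Variable P : rel_presentation S.
Local Notation X := (rp_gen P).

Lemma word_free_cat (u v : seq (rel_letter P)) :
  word_free (u ++ v) = word_free u * word_free v.
Proof. by rewrite /word_free big_cat. Qed.

Lemma word_value_cat (u v : seq (rel_letter P)) :
  word_value (u ++ v) = word_value u * word_value v.
Proof. by rewrite /word_value word_free_cat gmulfM. Qed.

Lemma word_value1 : word_value ([::] : seq (rel_letter P)) = 1.
Proof. by rewrite /word_value /word_free big_nil morph1. Qed.

(** The identity is not a letter and is spelled by the empty word. *)
Definition elt_word i (h : subgrp (S i)) : seq (rel_letter P) :=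
  if (insub h : option {h : subgrp (S i) | h != 1}) is Some h' then [:: inr (existT _ i h')] else [::].

Lemma word_free_elt i (h : subgrp (S i)) :
  word_free (elt_word h) = @felt (set_type X) I (fun i => subgrp (S i)) i h.
Proof.
rewrite /elt_word; case: insubP => [h' _ <-|]; first by rewrite /word_free big_seq1.
by rewrite negbK => /eqP->; rewrite /word_free big_nil morph1.
Qed.

Lemma size_elt_word i (h : subgrp (S i)) : (size (elt_word h) <= 1)%N.
Proof. by rewrite /elt_word; case: insub. Qed.

Lemma word_value_elt i (h : subgrp (S i)) : word_value (elt_word h) = val h.
Proof. by rewrite /word_value word_free_elt [LHS]flift_elt. Qed.

Lemma word_value_gen (x : set_type X) : word_value [:: inl x : rel_letter P] = val x.
Proof. by rewrite /word_value /word_free big_seq1 [LHS]flift_gen. Qed.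

Lemma word_value_letter i (h : {h : subgrp (S i) | h != 1}) :
  word_value [:: inr (existT _ i h) : rel_letter P] = val (val h).
Proof. by rewrite /word_value /word_free big_seq1 [LHS]flift_elt. Qed.

(** The inverse of a generator is again a letter by symmetry of the generating set; the equality
    holds in [G] but not in the free product. *)
Lemma word_valueV (u : seq (rel_letter P)) :
  exists v : seq (rel_letter P), word_value v = (word_value u)^-1.
Proof.
elim: u => [|a u [v vE]]; first by exists [::]; rewrite word_value1 invg1.
suff [w wE] : exists w : seq (rel_letter P), word_value w = (word_value [:: a])^-1.
  by exists (v ++ w); rewrite -cat1s !word_value_cat invgM vE wE.
case: a => [x|[i h]].
  have xV : X (val x)^-1 by apply/rp_sym/set_valP.
  by exists [:: inl (set_elt xV)]; rewrite !word_value_gen.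
by exists (elt_word (val h)^-1); rewrite word_value_elt subgrp_valV word_value_letter.
Qed.

Lemma word_value_surj g : exists u : seq (rel_letter P), word_value u = g.
Proof.
have : generated (X `|` \bigcup_i [set` S i])%classic g by rewrite rp_generated.
move: g; apply: generated_ind.
- by exists [::]; rewrite word_value1.
- by move=> x y [u <-] [v <-]; exists (u ++ v); rewrite word_value_cat.
- by move=> x [u <-]; exact: word_valueV.
move=> a [Xa|[i _ Sa]].
  by exists [:: inl (set_elt Xa)]; rewrite word_value_gen.
by exists (elt_word (Subgrp Sa : subgrp (S i))); rewrite word_value_elt.
Qed.

Lemma rel_proj_surj g : exists w, rel_proj S X w = g.
Proof. by have [u <-] := word_value_surj g; exists (word_free u). Qed.

Lemma rel_projP w : rel_proj S X w = 1 <-> normal_closure (rp_rel (r:=P)) w.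
Proof. by rewrite -rp_kernel. Qed.

Lemma rel_proj_rel r : rp_rel (r:=P) r -> rel_proj S X r = 1.
Proof. by move=> Rr; apply/rel_projP => N nN; apply. Qed.

(** Once some bound exists, a least number of factors exists, so exact areas may be traded for upper
    bounds. *)
Lemma rel_isoperimetricP f : rel_isoperimetric P f <->
  forall n (W : seq (rel_letter P)), (size W <= n)%N -> word_value W = 1 ->
    area (rp_rel (r:=P)) (f n) (word_free W).
Proof.
split=> isoP n W Wn W1.
  have [k [ck _] kf] := isoP n W Wn W1.
  by apply/conj_productP; exists k.
have /conj_productP[k kf ck] := isoP n W Wn W1.
pose p k := `[< conj_product k (word_free W) >].
have ex_p : exists k, p k by exists k; apply/asboolP.
case: (ex_minnP ex_p) => m /asboolP cm mP; exists m.
  by split=> // j cj; apply: mP; apply/asboolP.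
by apply: leq_trans kf; apply: mP; apply/asboolP.
Qed.

Lemma rel_dehn_exists f : rel_isoperimetric P f -> exists delta, is_rel_dehn P delta.
Proof.
move=> /rel_isoperimetricP isof.
pose p n m := `[< forall W : seq (rel_letter P), (size W <= n)%N ->
  word_value W = 1 -> area (rp_rel (r:=P)) m (word_free W) >].
have ex_p n : exists m, p n m by exists (f n); apply/asboolP => W; exact: isof.
exists (fun n => ex_minn (ex_p n)); split.
  apply/rel_isoperimetricP => n W Wn W1.
  by case: ex_minnP => m /asboolP pm _; exact: pm.
move=> g /rel_isoperimetricP isog n; case: ex_minnP => m _; apply.
by apply/asboolP => W; exact: isog.
Qed.
End WordValues.

(** * The HNN-extension relative to the H_l *)

Section Comparison.
Variables (H : groupType) (Lambda : Type) (S : Lambda -> groupClosed H).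
Variables (K : groupClosed H) (P : rel_presentation (adjoin S K)).
Variables (nu : Lambda) (iota : {multiplicative subgrp K -> subgrp (S nu)}).
Hypothesis iota_inj : injective iota.

Local Notation base := (hnn_base iota).
Local Notation t := (stable_letter iota).
Local Notation FP := (rel_free (adjoin S K) (rp_gen P)).
Local Notation HG := (fun l => image_subgroup base (S l)).

Lemma hnn_relation k : base (val k) = t * base (val (iota k)) * t^-1.
Proof.
have : qproj (hnn_relators iota) ((hnn_t H)^-1 * hnn_incl (val k) * hnn_t H *
    (hnn_incl (val (iota k)))^-1) = 1.
  by apply/esym/qprojP => N nN; rewrite invg1 mul1g; apply; exists k.
rewrite !gmulfM !morphV => /divg1_eq rel.
by rewrite [base (val (iota k))](esym rel) !mulgA mulgV mul1g mulgK.
Qed.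

Fact base_mem l (h : subgrp (S l)) : base (val h) \in HG l.
Proof. by apply/imgP; exists (val h) => //; exact: valP. Qed.

Definition base_subgrp l (h : subgrp (S l)) : subgrp (HG l) := Subgrp (base_mem h).

Fact base_subgrpM l : {morph @base_subgrp l : x y / x * y}.
Proof. move=> x y; apply: val_inj; rewrite valM /= -gmulfM.
by congr base; exact: (valM x y). Qed.

HB.instance Definition _ l :=
  isMultiplicative.Build _ _ (@base_subgrp l) (@base_subgrpM l).

(** * Transfer of words over [H] to free products over the HNN-extension *)

Section Target.
Variables (X : set (HNN iota)).
Local Notation F := (rel_free HG X).
Variables (lift : set_type (rp_gen P) -> F) (T : F).

Definition felt_base l (h : subgrp (S l)) : F :=
  @felt (set_type X) Lambda (fun l => subgrp (HG l)) l (base_subgrp h).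

Fact felt_baseM l : {morph @felt_base l : x y / x * y}.
Proof. by move=> x y; rewrite /felt_base (gmulfM (s := @base_subgrp l)) felt_morph. Qed.

HB.instance Definition _ l :=
  isMultiplicative.Build (subgrp (S l)) F (@felt_base l) (@felt_baseM l).

Definition felt_conj (k : subgrp K) : F := T * felt_base (iota k) * T^-1.

Fact felt_conjM : {morph felt_conj : x y / x * y}.
Proof.
move=> x y; rewrite /felt_conj (gmulfM (s := iota)) (gmulfM (s := @felt_base nu)).
by rewrite !mulgA mulgVK.
Qed.

HB.instance Definition _ := isMultiplicative.Build (subgrp K) F felt_conj felt_conjM.

(* An element k of K is read as T iota(k) T^-1, so no relation between
   elements of K is needed. *)
Definition transfer : {multiplicative FP -> F} :=
  flift lift (fun o => match o return {multiplicative subgrp (adjoin S K o) -> F} with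
    | Some l => @felt_base l | None => felt_conj end).
Lemma transfer_gen x : transfer (fgen _ x) = lift x.
Proof. exact: flift_gen. Qed.

Lemma transfer_elt l (h : subgrp (S l)) :
  transfer (@felt _ _ (fun o => subgrp (adjoin S K o)) (Some l) h) = felt_base h.
Proof. exact: flift_elt. Qed.

Lemma transfer_K (k : subgrp K) :
  transfer (@felt _ _ (fun o => subgrp (adjoin S K o)) None k) =
    T * felt_base (iota k) * T^-1.
Proof. exact: flift_elt. Qed.

Lemma proj_felt_base l (h : subgrp (S l)) : rel_proj HG X (felt_base h) = base (val h).
Proof. exact: flift_elt. Qed.

Hypothesis proj_lift : forall x, rel_proj HG X (lift x) = base (val x).
Hypothesis proj_T : rel_proj HG X T = t.

(** Both sides agree on generators, for those of [K] by the HNN relation. [X] and the lifts are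
    arbitrary, so as to cover both the constructed presentation and any other one. *)
Lemma proj_transfer w :
  rel_proj HG X (transfer w) = base (rel_proj (adjoin S K) (rp_gen P) w).
Proof.
pose f : {multiplicative FP -> HNN iota} := rel_proj HG X \o transfer.
pose g : {multiplicative FP -> HNN iota} := base \o rel_proj (adjoin S K) (rp_gen P).
apply: (freeprod_ext (h1 := f) (h2 := g)) => [x|[l|] a].
- rewrite /f /g /= transfer_gen proj_lift; congr base.
  exact/esym/flift_gen.
- rewrite /f /g /= transfer_elt proj_felt_base; congr base.
  exact/esym/flift_elt.
- rewrite /f /g /= transfer_K !gmulfM morphV proj_felt_base proj_T -hnn_relation.
  by congr base; exact/esym/flift_elt.
Qed.

Local Notation DP := (rel_letter P).
Local Notation hv := (fun d : DP => rel_proj (adjoin S K) (rp_gen P) (letter_free d)).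

Definition hnn_word_free (W : seq (DP + bool)) : F :=
  \prod_(a <- W) match a with inl d => transfer (letter_free d) | inr e => signed T e end.

Lemma hnn_word_free_cat U V :
  hnn_word_free (U ++ V) = hnn_word_free U * hnn_word_free V.
Proof. by rewrite /hnn_word_free big_cat. Qed.

Lemma hnn_word_free_inl u : hnn_word_free (map inl u) = transfer (word_free u).
Proof. by rewrite /hnn_word_free big_map [RHS]morph_prod. Qed.

Lemma hnn_word_free_inr e : hnn_word_free [:: inr e] = signed T e.
Proof. exact: big_seq1. Qed.

Lemma proj_hnn_word_free W : rel_proj HG X (hnn_word_free W) = hnn_value iota hv W.
Proof.
rewrite /hnn_word_free morph_prod; apply: eq_bigr => -[d|[]] _ //=.
- exact: proj_transfer.
- by rewrite /signed morphV proj_T.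
Qed.

Lemma base_value_word u : base_value hv u = word_value u.
Proof. by rewrite /word_value [RHS]morph_prod. Qed.

(* Reading a k in K as T iota(k) T^-1 makes the relation a t^e = t^e b hold
   already in the free product. *)
Lemma assoc_words e a b : assoc iota e a b ->
  exists u u' v : seq DP, [/\ (size u' <= 1)%N, (size v <= 1)%N,
    word_value u = a, word_free u' = (word_free u)^-1 &
    (signed T (~~ e)) * transfer (word_free u) * signed T e = transfer (word_free v)].
Proof.
pose wK (k : subgrp K) : seq DP := elt_word P (i := None) k.
pose wL (k : subgrp K) : seq DP := elt_word P (i := Some nu) (iota k).
have wKE k : transfer (word_free (wK k)) = T * felt_base (iota k) * T^-1.
  by rewrite word_free_elt transfer_K.
have wLE k : transfer (word_free (wL k)) = felt_base (iota k).
  by rewrite word_free_elt transfer_elt.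
have wKV k : word_free (wK k^-1) = (word_free (wK k))^-1.
  by rewrite !word_free_elt morphV.
have wLV k : word_free (wL k^-1) = (word_free (wL k))^-1.
  by rewrite !word_free_elt (morphV iota) morphV.
case: e => -[k [-> _]].
  exists (wK k), (wK k^-1), (wL k); split; rewrite ?size_elt_word ?word_value_elt //.
  by rewrite wKE wLE /signed !mulgA mulVg mul1g mulgVK.
exists (wL k), (wL k^-1), (wK k); split; rewrite ?size_elt_word ?word_value_elt //.
by rewrite wKE wLE.
Qed.

Variables (R : set F) (gamma : nat -> nat) (C : nat).
Hypothesis gamma_isop : rel_isoperimetric P gamma.
Hypothesis transfer_rel : forall r, rp_rel (r:=P) r -> area R C (transfer r).

Lemma area_transfer (u : seq DP) : word_value u = 1 ->
  area R (C * superadditive_closure gamma (size u)) (transfer (word_free u)).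
Proof.
(* At length 0 the closure is 0 and need not dominate [gamma 0], but the empty word costs
   nothing. *)
case: u => [_|a u u1]; first by rewrite /word_free big_nil morph1; exact: area_leq (area0 R).
have /rel_isoperimetricP/(_ _ _ (leqnn _) u1) := gamma_isop.
move=> /(area_morph transfer_rel); apply: area_leq.
by rewrite leq_mul2l leq_superadditive_closure ?orbT.
Qed.

Lemma area_hnn_word (W : seq (DP + bool)) : hnn_value iota hv W = 1 ->
  area R (C * superadditive_closure gamma (size W)) (hnn_word_free W).
Proof.
move: {2}(size W).+1 (ltnSn (size W)) => n.
elim: n W => [//|n IH] W; rewrite ltnS => Wn W1.
have [|[u WE]] := britton iota_inj W1; last first.
  rewrite base_value_word => u1.
  by rewrite WE hnn_word_free_inl size_map; exact: area_transfer.
move=> [e [p [u [q [b [WE]]]]]]; rewrite base_value_word => /assoc_words.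
move=> [u1 [u1' [v [size_u1' size_v u1E u1V u1v]]]].
pose W' := p ++ map inl v ++ q.
(* The word [u ++ u1'] compares [u] with a spelling of the same element of [H] by at most one
   letter. *)
pose y := word_free (u ++ u1').
have y1 : word_value (u ++ u1') = 1.
  rewrite word_value_cat -u1E -[word_value u1']/(rel_proj _ _ (word_free u1')).
  by rewrite u1V morphV mulgV.
(* This identity holds in the free product itself, so relators are spent on [y] and [W'] only. *)
have WW' : hnn_word_free W =
    transfer y ^ (hnn_word_free p * signed T (~~ e))^-1 * hnn_word_free W'.
  rewrite WE /W' !hnn_word_free_cat -cat1s -(cat1s (inr e)) !hnn_word_free_cat.
  rewrite !hnn_word_free_inl !hnn_word_free_inr -u1v /y word_free_cat gmulfM u1V.
  by rewrite morphV conjgE invgK invgM !mulgA !mulgVK.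
have W'1 : hnn_value iota hv W' = 1.
  rewrite -W1 -!proj_hnn_word_free WW' gmulfM morphJ proj_transfer.
  by rewrite [rel_proj _ _ y]y1 morph1 conj1g mul1g.
(* The pinch has [size u + 2] letters and leaves at most one, which makes room for the [size u + 1]
   letters of the comparison word. *)
have sizes : (size (u ++ u1') + size W' <= size W)%N.
  by rewrite WE /W' !size_cat /= size_cat !size_map /=; lia.
have W'n : (size W' < n)%N.
  by apply: leq_trans Wn; rewrite WE /W' !size_cat /= size_cat !size_map /=; lia.
rewrite WW'.
apply: area_leq (areaM (areaJ _ (area_transfer y1)) (IH _ W'n W'1)).
rewrite -mulnDr leq_mul2l; apply/orP; right.
by apply: leq_trans (superadditive_closureD _ _ _) _; exact: superadditive_closure_leq.
Qed.
End Target.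

(** * A relative presentation of the HNN-extension *)

Local Notation XH := (base @` rp_gen P `|` [set t; t^-1])%classic.

Fact base_XH (x : set_type (rp_gen P)) : XH (base (val x)).
Proof. by left; exists (val x) => //; exact: set_valP. Qed.
Fact stable_XH : XH t. Proof. by right; left. Qed.
Fact stableV_XH : XH t^-1. Proof. by right; right. Qed.

Local Notation FX := (rel_free HG XH).
Local Notation xgen Xa := (fgen (fun l => subgrp (HG l)) (set_elt Xa) : FX).

Definition hnn_lift (x : set_type (rp_gen P)) : FX := xgen (base_XH x).
Local Notation Phi := (transfer hnn_lift (xgen stable_XH)).

(* The last relator expresses that the basis elements t and t^-1 of F(XH) are
   mutually inverse. *)
Definition hnn_rel : set FX :=
  ((Phi : FP -> FX) @` rp_rel (r:=P) `|` [set xgen stable_XH * xgen stableV_XH])%classic.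

Lemma hnn_gen_sym x : XH x -> XH x^-1.
Proof.
move=> [[h Xh <-]|[->|->]]; last 2 first.
- exact: stableV_XH.
- by rewrite invgK; exact: stable_XH.
by left; exists h^-1; [exact: rp_sym | rewrite morphV].
Qed.

Lemma hnn_generated : generated (XH `|` \bigcup_l [set` HG l])%classic = setT.
Proof.
apply: generated_setT => N N1 NM NV NA g.
have Nt : N t by apply: NA; left; exact: stable_XH.
have NS l h : h \in S l -> N (base h).
  by move=> Sh; apply: NA; right; exists l => //=; apply/imgP; exists h.
have Nbase h : N (base h).
  have : generated (rp_gen P `|` \bigcup_o [set` adjoin S K o])%classic h.
    by rewrite rp_generated.
  move: h; apply: (generated_ind (N := fun h => N (base h))).
  - by rewrite morph1.
  - by move=> x y Nx Ny; rewrite gmulfM; exact: NM.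
  - by move=> x Nx; rewrite morphV; exact: NV.
  move=> h [Xh|[[l|] _ /= Sh]]; last 2 first.
  - exact: NS Sh.
  - rewrite -[h]/(val (Subgrp Sh)) hnn_relation.
    exact: NM _ _ (NM _ _ Nt (NS _ _ (valP _))) (NV _ Nt).
  by apply: NA; left; left; exists h.
rewrite -(qreprK g); apply: (freeprod_ind (N := fun w => N (qproj _ w))).
- by rewrite morph1.
- by move=> x y Nx Ny; rewrite gmulfM; exact: NM.
- by move=> x Nx; rewrite morphV; exact: NV.
- by case.
- by move=> [] h; exact: Nbase.
Qed.

Lemma hnn_proj_lift x : rel_proj HG XH (hnn_lift x) = base (val x).
Proof. exact: flift_gen. Qed.

Lemma proj_stable : rel_proj HG XH (xgen stable_XH) = t.
Proof. exact: flift_gen. Qed.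

(** For the inclusion of the kernel in the normal closure, a homomorphism [h3] from the
    HNN-extension to the quotient by [hnn_rel] is built whose composite with the projection is the
    quotient map. *)
Lemma hnn_kernel : [set w | rel_proj HG XH w = 1]%classic = normal_closure hnn_rel.
Proof.
apply/seteqP; split=> w; last first.
  apply: normal_closure_morph => r [[r' Rr' <-]|->].
    by rewrite (proj_transfer hnn_proj_lift proj_stable) rel_proj_rel ?morph1.
  by rewrite gmulfM proj_stable [X in _ * X]flift_gen mulgV.
pose pi : {multiplicative FX -> add_relations hnn_rel} := qproj hnn_rel.
pose piPhi : {multiplicative FP -> add_relations hnn_rel} := pi \o Phi.
have pi_rel r : hnn_rel r -> pi r = 1.
  by move=> Rr; apply/esym/qprojP => N nN; rewrite invg1 mul1g; apply.
(* [h1] is defined on [H] because [Phi] sends the relators of [P] into [hnn_rel]. *)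
have [|h1 h1E] := factor_morph (f := piPhi) (@rel_proj_surj _ _ _ P).
  move=> x /rel_projP; move: x; apply: normal_closure_morph => r Rr.
  by apply: pi_rel; left; exists r.
pose h2 : {multiplicative hnn_free H -> add_relations hnn_rel} :=
  flift (fun _ => pi (xgen stable_XH)) (fun _ => h1).
have h2t : h2 (hnn_t H) = pi (xgen stable_XH) by exact: flift_gen.
have h2H h : h2 (hnn_incl h) = h1 h by exact: (flift_elt _ (fun=> h1)).
have h1S l (h : subgrp (S l)) : h1 (val h) = pi (felt_base XH h).
  pose w' : FP := @felt _ _ (fun o => subgrp (adjoin S K o)) (Some l) h.
  have <- : rel_proj (adjoin S K) (rp_gen P) w' = val h by exact: flift_elt.
  by rewrite h1E /piPhi /= transfer_elt.
have h1K (k : subgrp K) : h1 (val k) =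
    pi (xgen stable_XH * felt_base XH (iota k) * (xgen stable_XH)^-1).
  pose w' : FP := @felt _ _ (fun o => subgrp (adjoin S K o)) None k.
  have <- : rel_proj (adjoin S K) (rp_gen P) w' = val k by exact: flift_elt.
  by rewrite h1E /piPhi /= transfer_K.
have [|g|h3 h3E] := factor_morph (p := qproj (hnn_relators iota)) (f := h2).
- by move=> g; exists (repr g); exact: qreprK.
- move=> /esym/qprojP; rewrite invg1 mul1g; move: g.
  apply: normal_closure_morph => _ [k ->].
  rewrite !gmulfM !morphV h2t !h2H h1S h1K !gmulfM morphV.
  by rewrite !mulgA mulVg mul1g mulgVK mulgV.
have h3t : h3 t = pi (xgen stable_XH) by rewrite h3E.
have h3base h : h3 (base h) = h1 h by rewrite h3E h2H.
pose h3p : {multiplicative FX -> add_relations hnn_rel} := h3 \o rel_proj HG XH.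
have h3pE : h3p =1 pi.
  apply: freeprod_ext => [x|l a]; rewrite /h3p /=.
    have -> : rel_proj HG XH (fgen _ x) = val x by exact: flift_gen.
    have xE a (Xa : XH a) : val x = a -> x = set_elt Xa by move=> xa; apply: val_inj.
    case: (set_valP x) => [[h Xh hx]|[xt|xt]].
    - rewrite -hx h3base (xE _ (base_XH (set_elt Xh))) //.
      pose w' : FP := fgen _ (set_elt Xh).
      have w'E : rel_proj (adjoin S K) (rp_gen P) w' = h by exact: flift_gen.
      by have := h1E w'; rewrite w'E /piPhi /= transfer_gen.
    - by rewrite xt h3t (xE _ stable_XH).
    - rewrite xt morphV h3t (xE _ stableV_XH) //.
      (* The extra relator makes the generator [t^-1] the inverse of the generator [t] in the
         quotient. *)
      by apply: mulg1_eq; rewrite -gmulfM; apply: pi_rel; right.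
  have /imgP[h0 Sh0 h0E] := valP a.
  have -> : rel_proj HG XH (@felt _ _ (fun l => subgrp (HG l)) l a) = val a.
    exact: flift_elt.
  rewrite -h0E h3base (h1S l (Subgrp Sh0)); rewrite /felt_base.
  by have -> : base_subgrp (Subgrp Sh0) = a by exact: val_inj.
move=> w1; have /esym := h3pE w; rewrite /h3p /= [rel_proj _ _ _]w1 morph1.
by move=> /esym/qprojP; rewrite invg1 mul1g.
Qed.

Definition hnn_presentation : rel_presentation HG :=
  RelPresentation hnn_gen_sym hnn_generated hnn_kernel.

Lemma hnn_finitely_presented_rel :
  finite_rel_presentation P -> finitely_presented_rel HG.
Proof.
move=> [Xfin Rfin]; exists hnn_presentation; split.
  rewrite /= finite_setU finite_setU; split; first exact: finite_image.
  by split; exact: finite_set1.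
by rewrite /= /hnn_rel finite_setU; split; [exact: finite_image | exact: finite_set1].
Qed.

(** * The Dehn function of an arbitrary finite relative presentation *)

Section DehnBound.
Variable Q : rel_presentation HG.
Hypotheses (P_finite : finite_rel_presentation P) (Q_finite : finite_rel_presentation Q).
Local Notation RQ := (rp_rel (r:=Q)).
Local Notation DP := (rel_letter P).
Local Notation hv := (fun d : DP => rel_proj (adjoin S K) (rp_gen P) (letter_free d)).

Lemma hnn_value_cat (U V : seq (DP + bool)) :
  hnn_value iota hv (U ++ V) = hnn_value iota hv U * hnn_value iota hv V.
Proof. by rewrite /hnn_value big_cat. Qed.

Lemma hnn_value_base h : exists W : seq (DP + bool), hnn_value iota hv W = base h.
Proof.
have [u <-] := word_value_surj P h; exists (map inl u).
by rewrite -base_value_word /hnn_value big_map /base_value [RHS]morph_prod.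
Qed.

Lemma hnn_value_surj g : exists W : seq (DP + bool), hnn_value iota hv W = g.
Proof.
have NT e : exists W : seq (DP + bool), hnn_value iota hv W = signed t e.
  by exists [:: inr e]; rewrite /hnn_value big_seq1.
have : generated (XH `|` \bigcup_l [set` HG l])%classic g by rewrite hnn_generated.
move: g; apply: generated_ind.
- by exists [::]; rewrite /hnn_value big_nil.
- by move=> x y [U <-] [V <-]; exists (U ++ V); rewrite hnn_value_cat.
- move=> x [U <-]; elim: U => [|a U [V IH]].
    by exists [::]; rewrite /hnn_value big_nil invg1.
  rewrite /hnn_value big_cons invgM -[(\prod_(j <- U) _)^-1]IH.
  suff [W <-] : exists W : seq (DP + bool), hnn_value iota hv W =
      (match a with inl d => base (hv d) | inr e => signed t e end)^-1.
    by exists (V ++ W); exact: hnn_value_cat.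
  case: a => [d|[]]; first by rewrite -morphV; exact: hnn_value_base.
    exact: (NT false).
  by rewrite /signed invgK; exact: (NT true).
move=> a [[[h _ <-]|[->|->]]|[l _ /imgP[h _ <-]]].
- exact: hnn_value_base.
- exact: (NT true).
- exact: (NT false).
- exact: hnn_value_base.
Qed.

Lemma area_kernel w : rel_proj HG (rp_gen Q) w = 1 -> exists n, area RQ n w.
Proof. by move=> /rel_projP/normal_closure_area. Qed.

(** A word over [Q] is rewritten over the letters of [P] and the stable letter, with linear length
    and cost; the result is bounded by [area_hnn_word]. *)
Lemma hnn_dehn_bound gamma : rel_isoperimetric P gamma ->
  exists B C : nat, rel_isoperimetric Q
    (fun n => C * superadditive_closure gamma (B * n) + C * n)%N.
Proof.
move=> gamma_isop.
have /choice[lift liftE] : forall x : set_type (rp_gen P), exists w,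
    rel_proj HG (rp_gen Q) w = base (val x).
  by move=> x; exact: (rel_proj_surj Q).
have [T TE] := rel_proj_surj Q t.
have [C transfer_rel] : exists C, forall r, rp_rel (r:=P) r -> area RQ C (transfer lift T r).
  have [_ Rfin] := P_finite.
  apply: (finite_uniform_bound (N := fun C r => area RQ C (transfer lift T r)) Rfin).
    by move=> m n r; exact: area_leq.
  move=> r Rr; apply: area_kernel.
  by rewrite (proj_transfer liftE TE) rel_proj_rel ?morph1.
(* One number bounds both the length of the rewritten word and the cost of rewriting. *)
pose near n (w : rel_free HG (rp_gen Q)) := exists2 W : seq (DP + bool),
  (size W <= n)%N & area RQ n (w * (hnn_word_free lift T W)^-1).
have near_leq m n w : (m <= n)%N -> near m w -> near n w.
  by move=> mn [W Wm aW]; exists W; [exact: leq_trans mn | exact: area_leq aW].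
have [B nearB] : exists B, forall a : rel_letter Q, near B (letter_free a).
  have [Xfin _] := Q_finite.
  have [B nearB] : exists B, forall g, rp_gen Q g ->
      forall x : set_type (rp_gen Q), val x = g -> near B (fgen _ x).
    apply: (finite_uniform_bound (N := fun B g =>
      forall x : set_type (rp_gen Q), val x = g -> near B (fgen _ x)) Xfin).
      by move=> m n g mn gP x xg; exact: near_leq mn (gP x xg).
    move=> g Xg; have [W WE] := hnn_value_surj g.
    have [|n an] := @area_kernel (fgen _ (set_elt Xg) * (hnn_word_free lift T W)^-1).
      rewrite gmulfM morphV (proj_hnn_word_free liftE TE) WE.
      by rewrite [X in X * _]flift_gen mulgV.
    exists (maxn (size W) n) => x xg.
    have -> : x = set_elt Xg by exact: val_inj.
    by exists W; [exact: leq_maxl | exact: area_leq (leq_maxr _ _) an].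
  (* The successor allows one letter: an element of a subgroup is spelled by at most one letter at
     no cost, so the bound is uniform over possibly infinitely many letters. *)
  exists B.+1 => -[x|[l h]].
    by apply: near_leq (leqnSn B) _; apply: nearB (set_valP x) _ _.
  have /imgP[h0 Sh0 h0E] := valP (val h).
  exists (map inl (elt_word P (i := Some l) (Subgrp Sh0))).
    by rewrite size_map (leq_trans (size_elt_word _ _)).
  rewrite hnn_word_free_inl word_free_elt transfer_elt /felt_base.
  have -> : base_subgrp (Subgrp Sh0) = val h by exact: val_inj.
  by rewrite mulgV; apply: area_leq (area0 RQ).
have near_word (W : seq (rel_letter Q)) : near (B * size W)%N (word_free W).
  elim: W => [|a W [V Vn aV]].
    exists [::] => //; rewrite /word_free /hnn_word_free !big_nil invg1 mulg1 muln0.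
    exact: area0.
  have [U Un aU] := nearB a; exists (U ++ V).
    by rewrite size_cat /= mulnS leq_add.
  rewrite mulnS hnn_word_free_cat invgM /word_free big_cons.
  have := areaM aU (areaJ (hnn_word_free lift T U)^-1 aV).
  by rewrite conjgE invgK !mulgA mulgVK.
(* [C] is the factor of the closure and [B] the slope of the rewriting cost; their maximum serves as
   both. *)
exists B, (maxn B C); apply/rel_isoperimetricP => n W Wn W1.
have [V Vn aV] := near_word W.
have V1 : hnn_value iota hv V = 1.
  rewrite -(proj_hnn_word_free liftE TE) -W1.
  have /rel_projP := area_normal_closure aV.
  by rewrite gmulfM morphV => /divg1_eq/esym.
have := areaM aV (area_hnn_word liftE TE gamma_isop transfer_rel V1).
rewrite mulgVK; apply: area_leq; rewrite addnC leq_add //.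
  apply: leq_mul; first exact: leq_maxr.
  by apply: superadditive_closure_leq; apply: leq_trans Vn _; rewrite leq_mul2l Wn orbT.
by apply: leq_mul => //; exact: leq_maxl.
Qed.
End DehnBound.
End Comparison.

Theorem theorem1p2 (H : groupType) (Lambda : Type)
  (S : Lambda -> groupClosed H) (K : groupClosed H)
  (P : rel_presentation (adjoin S K)) (P_finite : finite_rel_presentation P)
  (gamma : nat -> nat) (gamma_dehn : is_rel_dehn P gamma)
  (K_fg : finitely_generated K)
  (nu : Lambda) (iota : {multiplicative subgrp K -> subgrp (S nu)})
  (iota_inj : injective iota) :
  let HG : Lambda -> groupClosed (HNN iota) :=
    fun l => image_subgroup (hnn_base iota) (S l) in
  finitely_presented_rel HG /\
  forall Q : rel_presentation HG, finite_rel_presentation Q ->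
    exists2 delta : nat -> nat, is_rel_dehn Q delta &
      fun_preceq delta
        (superadditive_closure gamma \o superadditive_closure gamma).
Proof.
move=> HG; split; first exact: hnn_finitely_presented_rel P_finite.
move=> Q Q_finite.
have [gamma_isop _] := gamma_dehn.
have [B [C isopQ]] := hnn_dehn_bound iota_inj P_finite Q_finite gamma_isop.
have [delta deltaQ] := rel_dehn_exists isopQ; exists delta => //.
(* The bound found involves the closure once; enlarging the argument by the factor [m] bounds it by
   the composite. The successors below make the constants positive. *)
have [m m_gt0 gbar_comp] := superadditive_closure_comp gamma.
exists C.+1, (m * B.+1)%N, C.+1; split=> //; first by rewrite muln_gt0 m_gt0.
move=> n; have [_ /(_ _ isopQ n)] := deltaQ; move/leq_trans; apply.
apply: leq_add; last by rewrite leq_mul2r leqnSn orbT.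
apply: leq_mul => //=; rewrite -mulnA.
apply: leq_trans (gbar_comp _); apply: superadditive_closure_leq.
by rewrite leq_mul2r leqnSn orbT.
Qed.
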